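(* Let $X$ be a topological space, $Y$ a normed space, $\mathcal{B}$ the family of balls $B(r)=\{y\in Y:\|y\|<r\}$, $r>0$, let $F_1,F_2:X\to 2^Y$ be multifunctions, and let $F=F_1\cap F_2$, i.e. $F(x)=F_1(x)\cap F_2(x)$ for $x\in X$. If $F_1$ and $F_2$ are $\mathcal{B}$-lsc at $x_0\in X$, locally convex-valued and locally closed-valued at $x_0$, and $\operatorname{int}F(x_0)\neq\emptyset$, then $F$ is $\mathcal{B}$-lsc at $x_0$, and hence V-lsc at $x_0$.
   Context: $2^Y$ is the family of all subsets of $Y$ (including $\emptyset$); a multifunction from $X$ to $Y$ is a map $F:X\to 2^Y$. The normed space $Y$ carries its norm topology and natural uniformity; $\operatorname{int}$ denotes interior in $Y$. $F$ is $\mathcal{B}$-lsc at $x_0$ if for every neighbourhood $V$ of $0$ in $Y$ and every $B\in\mathcal{B}$ there is a neighbourhood $U(x_0)$ of $x_0$ such that $F(x_0)\cap B\subset F(x)+V$ for every $x\in U(x_0)$, where $C+D=\{c+d:c\in C,\ d\in D\}$. $F$ is V-lsc at $x_0$ if for every open $G\subset Y$ with $F(x_0)\cap G\neq\emptyset$ there is a neighbourhood $U(x_0)$ of $x_0$ such that $F(x)\cap G\neq\emptyset$ for every $x\in U(x_0)$. A multifunction $F$ is locally convex-valued (respectively locally closed-valued) at $x_0$ if there is a neighbourhood $U$ of $x_0$ such that $F(x)$ is convex (respectively closed) for every $x\in U$. *)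

(* Defs.v *)
From HB Require Import structures.
From mathcomp Require Import all_boot all_order all_algebra.
From mathcomp Require Import all_classical all_reals all_analysis.

Set Implicit Arguments.
Unset Strict Implicit.
Unset Printing Implicit Defensive.

Import Order.TTheory GRing.Theory Num.Theory.
Import numFieldNormedType.Exports.

Local Open Scope classical_set_scope.
Local Open Scope ring_scope.

(* A multifunction from X to Y is a map F : X -> set Y; empty values are
   allowed. *)

Definition set_add (Y : zmodType) (C D : set Y) : set Y :=
  [set c + d | c in C & d in D].

Definition family_lsc (R : realType) (X : topologicalType)
    (Y : normedModType R) (B : set (set Y)) (F : X -> set Y) (x0 : X) : Prop :=
  forall V : set Y, nbhs 0 V -> forall b : set Y, B b ->
    \forall x \near x0, F x0 `&` b `<=` set_add (F x) V.

Definition vietoris_lsc (X Y : topologicalType) (F : X -> set Y) (x0 : X)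
    : Prop :=
  forall G : set Y, open G -> F x0 `&` G !=set0 ->
    \forall x \near x0, F x `&` G !=set0.

Definition locally_convex_valued (R : realType) (X : topologicalType)
    (Y : normedModType R) (F : X -> set Y) (x0 : X) : Prop :=
  \forall x \near x0, convex_set (F x).

Definition locally_closed_valued (X Y : topologicalType) (F : X -> set Y)
    (x0 : X) : Prop :=
  \forall x \near x0, closed (F x).

Definition centered_balls (R : realType) (Y : normedModType R)
    : set (set Y) :=
  [set [set y : Y | `|y| < r] | r in [set r : R | 0 < r]].

Definition multi_cap (X Y : Type) (F1 F2 : X -> set Y) : X -> set Y :=
  fun x => F1 x `&` F2 x.

(* Main.v *)
(** A ball about [c] inside [F x0] is approximated by each [Fi x] for [x] near
    [x0]; since [Fi x] is closed and convex, it then contains a smaller ball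
    about [c] of a radius [d] independent of [x].  A point [y] of [F x0] is
    close to points [ui] of [Fi x], and these need not agree for [i = 1, 2];
    but sliding [y] slightly towards [c] gives one point lying in the convex
    hull of [ui] and the ball for both [i], hence in [F x].  Boundedness of the
    set of [y]'s makes the size of the slide uniform. *)
Require Import Defs.
From HB Require Import structures.
From mathcomp Require Import all_boot all_order all_algebra.
From mathcomp Require Import all_classical all_reals all_analysis.
From mathcomp Require Import ring lra.

Set Implicit Arguments.
Unset Strict Implicit.
Unset Printing Implicit Defensive.

Import Order.TTheory GRing.Theory Num.Theory.
Import numFieldNormedType.Exports.

Local Open Scope classical_set_scope.
Local Open Scope ring_scope.

Lemma convex_set_comb (R : realType) (Y : normedModType R) (C : set Y)
    (x y : Y) (t : R) :
  convex_set C -> C x -> C y -> 0 <= t <= 1 -> C (t *: x + (1 - t) *: y).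
Proof.
move=> Cconv Cx Cy /andP[t0 t1].
have := Cconv x y (Itv01 t0 t1) (mem_set Cx) (mem_set Cy).
by move/set_mem.
Qed.

Lemma closed_approx (R : realType) (Y : normedModType R) (C : set Y) (y : Y) :
  closed C -> (forall e : R, 0 < e -> exists2 z, C z & `|y - z| < e) -> C y.
Proof.
move=> Cclosed approx; apply: Cclosed => V /nbhs_ballP[e /= e0 yV].
have [z Cz yz] := approx e e0.
by exists z; split=> //; apply: yV; rewrite -ball_normE.
Qed.

(* If [z] lies in [C] at distance [d] from [y], push [y] away from [z] by
   [2 * e]: a point of [C] within [e] of the result, averaged with [z], is a
   point of [C] within [d / 2] of [y]. *)
Lemma convex_halve_dist (R : realType) (Y : normedModType R) (C : set Y)
    (y z : Y) (e : R) :
  convex_set C -> 0 < e ->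
  (forall w, `|w - y| <= 2 * e -> exists2 u, C u & `|w - u| < e) ->
  C z -> exists2 u, C u & `|y - u| <= `|y - z| / 2.
Proof.
move=> Cconv e0 near_C Cz.
have [<-|yz] := eqVneq z y; first by exists z; rewrite // subrr normr0 mul0r.
have d0 : 0 < `|y - z| by rewrite normr_gt0 subr_eq0 eq_sym.
set t := 2 * e / `|y - z|.
have t0 : 0 < t by rewrite divr_gt0// mulr_gt0.
have tD0 : 0 < 1 + t by rewrite addr_gt0.
have [|u Cu wu] := near_C (y + t *: (y - z)).
  by rewrite addrC addKr normrZ gtr0_norm// divfK// gt_eqF.
(* With these weights the average of the pushed point [y + t *: (y - z)] and [z] is exactly [y], so
   only the error of [u], shrunk by [1 + t], remains. *)
exists ((1 + t)^-1 *: u + (1 - (1 + t)^-1) *: z).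
  apply: convex_set_comb => //.
  by rewrite invr_ge0 ltW//= invf_le1// lerDl ltW.
have -> : y - ((1 + t)^-1 *: u + (1 - (1 + t)^-1) *: z) =
    (1 + t)^-1 *: (y + t *: (y - z) - u).
  have -> : 1 - (1 + t)^-1 = (1 + t)^-1 * t by field; rewrite gt_eqF.
  have {1}-> : y = (1 + t)^-1 *: ((1 + t) *: y).
    by rewrite scalerA mulVf ?scale1r// gt_eqF.
  rewrite -scalerA -!scalerDr -scalerBr; congr (_ *: _).
  by rewrite scalerDl scale1r scalerBr opprD [- u - _]addrC !addrA.
rewrite normrZ gtr0_norm ?invr_gt0// ler_pdivrMl// (le_trans (ltW wu))//.
have -> : (1 + t) * (`|y - z| / 2) = `|y - z| / 2 + e.
  by rewrite /t; field; rewrite gt_eqF.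
by rewrite lerDr divr_ge0.
Qed.

(** Repeated halving, started at any [z0] in [C], produces points of [C] converging to [y];
    closedness then gives [y] itself. *)
Lemma closed_convex_mem (R : realType) (Y : normedModType R) (C : set Y)
    (y : Y) (e : R) :
  closed C -> convex_set C -> 0 < e ->
  (forall w, `|w - y| <= 2 * e -> exists2 u, C u & `|w - u| < e) -> C y.
Proof.
move=> Cclosed Cconv e0 near_C.
have [|z0 Cz0 _] := near_C y; first by rewrite subrr normr0 mulr_ge0// ltW.
have approx n : exists2 z, C z & `|y - z| <= `|y - z0| / 2 ^+ n.
  elim: n => [|n [z Cz yz]]; first by exists z0; rewrite // expr0 divr1.
  have [u Cu yu] := convex_halve_dist Cconv e0 near_C Cz.
  exists u => //; apply: (le_trans yu).
  by rewrite exprS invfM mulrCA mulrC ler_pM2l ?invr_gt0.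
apply: closed_approx => // d d0.
(* An Archimedean bound is enough, since [n < 2 ^ n]. *)
have [n Hn] : exists n, `|y - z0| / d < n%:R.
  by exists (Num.truncn (`|y - z0| / d)).+1; rewrite truncnS_gt.
have [z Cz yz] := approx n; exists z => //; apply: (le_lt_trans yz).
rewrite ltr_pdivrMr ?exprn_gt0// mulrC -ltr_pdivrMr//.
by apply: (lt_trans Hn); rewrite -natrX ltr_nat ltn_expl.
Qed.

Lemma centered_ball_lsc (R : realType) (X : topologicalType)
    (Y : normedModType R) (F : X -> set Y) (x0 : X) (r e : R) :
  family_lsc (@centered_balls R Y) F x0 -> 0 < r -> 0 < e ->
  \forall x \near x0, forall y, F x0 y -> `|y| < r ->
    exists2 u, F x u & `|y - u| < e.
Proof.
move=> Flsc r0 e0.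
have Br : centered_balls [set y : Y | `|y| < r] by exists r.
have := Flsc _ (nbhsx_ballx (0 : Y) e e0) _ Br.
apply: filterS => x sub y Fy yr.
have [u Fu [v + <-]] := sub y (conj Fy yr).
rewrite -ball_normE /= sub0r normrN => ve.
by exists u => //; rewrite addrC addKr.
Qed.

(** The factor 4 leaves room for the test points: [w] within [2 * d] of [y] is within [3 * d] of
    [c], hence in [F x0]. All such [w] lie in one centered ball, so a single neighbourhood of [x0]
    serves them all. *)
Lemma locally_contains_ball (R : realType) (X : topologicalType)
    (Y : normedModType R) (F : X -> set Y) (x0 : X) (c : Y) (d : R) :
  family_lsc (@centered_balls R Y) F x0 ->
  locally_convex_valued F x0 -> locally_closed_valued F x0 ->
  0 < d -> (forall y, `|y - c| < 4 * d -> F x0 y) ->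
  \forall x \near x0, forall y, `|y - c| < d -> F x y.
Proof.
move=> Flsc Fconv Fclosed d0 ballF.
have r0 : 0 < `|c| + 4 * d by rewrite ltr_wpDl// mulr_gt0.
apply: filterS3 Fclosed Fconv (centered_ball_lsc Flsc r0 d0).
move=> x Fxclosed Fxconv Fxapprox y yc.
apply: (closed_convex_mem Fxclosed Fxconv d0) => w wy.
have wc : `|w - c| < 4 * d.
  by rewrite (le_lt_trans (ler_distD y _ _))//; lra.
apply: Fxapprox; first exact: ballF.
by rewrite -[w](subrK c) addrC (le_lt_trans (ler_normD _ _))// ltrD2l.
Qed.

Lemma family_lsc_vietoris (R : realType) (X : topologicalType)
    (Y : normedModType R) (F : X -> set Y) (x0 : X) :
  family_lsc (@centered_balls R Y) F x0 -> vietoris_lsc F x0.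
Proof.
move=> Flsc G Gopen [y [Fy Gy]].
have /nbhs_ballP[e /= e0 yG] : nbhs y G by exact: open_nbhs_nbhs.
(* A centered ball of this radius contains [y]. *)
have r0 : 0 < `|y| + 1 by rewrite ltr_wpDl.
have := centered_ball_lsc Flsc r0 e0.
apply: filterS => x /(_ y Fy); rewrite ltrDl ltr01 => /(_ isT)[u Fu yu].
by exists u; split=> //; apply: yG; rewrite -ball_normE.
Qed.

(* The point [(1 - l) y + l c] can be written with [y] replaced by a nearby
   point [u] of [C], moving the error to the centre [c], where it is amplified
   by at most [1 / l]. *)
Lemma convex_shift_mem (R : realType) (Y : normedModType R) (C : set Y)
    (c y u : Y) (d l : R) :
  convex_set C -> 0 < l <= 1 -> (forall w, `|w - c| < d -> C w) ->
  C u -> `|y - u| < l * d -> C (l *: c + (1 - l) *: y).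
Proof.
move=> Cconv /andP[l0 l1] ballC Cu yu.
have -> : l *: c + (1 - l) *: y =
    l *: (c + ((1 - l) / l) *: (y - u)) + (1 - l) *: u.
  rewrite scalerDr scalerA mulrCA divff ?gt_eqF// mulr1 scalerBr -!addrA.
  by rewrite addNr addr0.
apply: convex_set_comb => //; last by rewrite ltW.
apply: ballC; rewrite addrC addKr normrZ ger0_norm; last first.
  by rewrite divr_ge0 ?subr_ge0// ltW.
rewrite mulrAC ltr_pdivrMr// (le_lt_trans _ (_ : `|y - u| < _))//; last first.
  by rewrite mulrC.
by rewrite ler_piMl// gerBl ltW.
Qed.

Theorem theorem4p3 (R : realType) (X : topologicalType) (Y : normedModType R)
    (F1 F2 : X -> set Y) (x0 : X)
    (F1_lsc : family_lsc (@centered_balls R Y) F1 x0)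
    (F2_lsc : family_lsc (@centered_balls R Y) F2 x0)
    (F1_convex : locally_convex_valued F1 x0)
    (F2_convex : locally_convex_valued F2 x0)
    (F1_closed : locally_closed_valued F1 x0)
    (F2_closed : locally_closed_valued F2 x0)
    (F_int : interior (multi_cap F1 F2 x0) !=set0) :
  family_lsc (@centered_balls R Y) (multi_cap F1 F2) x0 /\
  vietoris_lsc (multi_cap F1 F2) x0.
Proof.
suff Flsc : family_lsc (@centered_balls R Y) (multi_cap F1 F2) x0.
  by split=> //; exact: family_lsc_vietoris.
case: F_int => c /nbhs_ballP[rho /= rho0 ballF].
pose d := rho / 4.
have d0 : 0 < d by rewrite divr_gt0.
have ballF' y : `|y - c| < 4 * d -> multi_cap F1 F2 x0 y.
  rewrite /d mulrC divfK// => yc.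
  by apply: ballF; rewrite -ball_normE /= distrC.
move=> V /nbhs_ballP[eta /= eta0 ballV] _ [r /= r0 <-].
(* The slide displaces [y] by [l *: (y - c)], of norm below [l] times [r] plus the norm of [c]; this
   [l] keeps that below [eta]. The summand [eta] in the denominator ensures [l <= 1]. *)
pose l := eta / (eta + (r + `|c|)).
have s0 : 0 < eta + (r + `|c|) by rewrite addr_gt0// ltr_pwDl.
have l0 : 0 < l by rewrite divr_gt0.
have l1 : l <= 1 by rewrite ler_pdivrMr// mul1r lerDl addr_ge0// ltW.
have ld0 : 0 < l * d by rewrite mulr_gt0.
have F1c := locally_contains_ball F1_lsc F1_convex F1_closed d0
  (fun y yc => (ballF' y yc).1).
have F2c := locally_contains_ball F2_lsc F2_convex F2_closed d0
  (fun y yc => (ballF' y yc).2).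
have l01 : 0 < l <= 1 by rewrite l0.
(* The slid point depends only on [c], [l] and [y], so [F1] and [F2] yield the same one. *)
have shift F : locally_convex_valued F x0 ->
    (\forall x \near x0, forall y, `|y - c| < d -> F x y) ->
    family_lsc (@centered_balls R Y) F x0 ->
    \forall x \near x0, forall y, F x0 y -> `|y| < r ->
      F x (l *: c + (1 - l) *: y).
  move=> Fconv Fball Flsc.
  apply: filterS3 Fconv Fball (centered_ball_lsc Flsc r0 ld0).
  move=> x Fxconv Fxball Fxapprox y Fy yr.
  have [u Fu yu] := Fxapprox y Fy yr.
  exact: convex_shift_mem Fxconv l01 Fxball Fu yu.
apply: filterS2 (shift F1 F1_convex F1c F1_lsc) (shift F2 F2_convex F2c F2_lsc).
move=> x F1x F2x y [[F1y F2y] yr].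
exists (l *: c + (1 - l) *: y); first by split; [exact: F1x|exact: F2x].
exists (l *: (y - c)); last first.
  rewrite scalerBr scalerBl scale1r addrC addrA subrK addrC subrK//.
apply: ballV; rewrite -ball_normE /= sub0r normrN normrZ gtr0_norm//.
rewrite /l mulrAC ltr_pdivrMr// ltr_pM2l//.
rewrite (le_lt_trans (ler_normB _ _))//.
by rewrite -[ltLHS]add0r ltrD// ltrD2r.
Qed.
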